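(* Suppose $n \geq 2$, $F$ is a field with $\operatorname{char}(F)=2$, $I_q^n F \neq 0$ and $I_q^n F$ is separably linked. Then $u^n(F)$ is either $2^n$ or $2^{n+1}$. Moreover, every anisotropic form $\varphi \in I_q^n F$ of dimension $u^n(F)$ is Witt equivalent to $\pi \perp \psi$ for some $\pi \in P_n(F)$ and $\psi \in P_{n+1}(F)$.
   Context: Let $F$ be a field of characteristic $2$. $[1,\alpha]$ denotes the two-dimensional quadratic form $u^2+uv+\alpha v^2$; $\langle\langle\alpha]]=[1,\alpha]$ is a quadratic $1$-fold Pfister form, and quadratic $n$-fold Pfister forms are defined recursively by $\langle\langle\beta_{n-1},\dots,\beta_1,\alpha]]=\langle\langle\beta_{n-2},\dots,\beta_1,\alpha]]\perp\beta_{n-1}\langle\langle\beta_{n-2},\dots,\beta_1,\alpha]]$ with $\alpha\in F$, $\beta_i\in F^\times$. $P_n(F)$ is the set of quadratic $n$-fold Pfister forms over $F$. $W_qF=I_q^1F$ is the Witt group of nonsingular quadratic forms over $F$, and $I_q^nF$ is its subgroup generated by scalar multiples of quadratic $n$-fold Pfister forms; a form is said to be in $I_q^nF$ if its Witt class is. $u^n(F)$ denotes the maximal dimension of an anisotropic form in $I_q^nF$. Two quadratic Pfister forms $\varphi,\psi$ are separably $k$-linked if there exists $\phi\in P_k(F)$ such that $\varphi=\varphi'\otimes\phi$ and $\psi=\psi'\otimes\phi$ for some bilinear Pfister forms $\varphi',\psi'$ (a bilinear Pfister form being $\langle\langle\beta_1,\dots,\beta_r\rangle\rangle=\langle1,\beta_1\rangle\otimes\dots\otimes\langle1,\beta_r\rangle$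 with $\beta_i\in F^\times$). $I_q^nF$ is separably linked if every two quadratic $n$-fold Pfister forms over $F$ are separably $(n-1)$-linked. *)

(* Defs.v *)
From HB Require Import structures.
From mathcomp Require Import all_boot all_order all_algebra.
From mathcomp.real_closed Require Import mxtens.

Set Implicit Arguments.
Unset Strict Implicit.
Unset Printing Implicit Defensive.

Import GRing.Theory.
Local Open Scope ring_scope.

Section QuadraticForms.

Variable F : fieldType.

(* A quadratic form on the row space F^d, given by any matrix A with
   q(x) = x A x^T.  Several matrices represent the same form (A is only
   determined modulo alternating matrices), so forms are never compared by
   Leibniz equality but by [isometric] or [witt_equiv] below. *)
Record qform := QForm { qdim : nat; qmx : 'M[F]_qdim }.

Definition qeval (q : qform) (x : 'rV[F]_(qdim q)) : F :=
  (x *m qmx q *m x^T) 0 0.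

Arguments qeval q x : clear implicits.
Coercion qeval : qform >-> Funclass.

Definition qpolar (q : qform) (x y : 'rV[F]_(qdim q)) : F :=
  q (x + y) - q x - q y.

Arguments qpolar q x y : clear implicits.

Definition nonsingular (q : qform) : Prop :=
  forall x, (forall y, qpolar q x y = 0) -> x = 0.

Definition anisotropic (q : qform) : Prop :=
  forall x : 'rV[F]_(qdim q), x != 0 -> q x != 0.

Definition isometric (q1 q2 : qform) : Prop :=
  exists2 f : {linear 'rV[F]_(qdim q1) -> 'rV[F]_(qdim q2)},
    bijective f & forall x, q2 (f x) = q1 x.

Definition qorth (q1 q2 : qform) : qform :=
  QForm (block_mx (qmx q1) 0 0 (qmx q2)).

Definition qscale (c : F) (q : qform) : qform := QForm (c *: qmx q).

Definition qzero : qform := QForm (0 : 'M[F]_0).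

(* [a, b] = a u^2 + u v + b v^2 *)
Definition qbinary (a b : F) : qform :=
  QForm (block_mx a%:M 1%:M 0 b%:M : 'M[F]_(1 + 1)).

Definition hyperbolic (i : nat) : qform :=
  iter i (qorth (qbinary 0 0)) qzero.

(* Equality of classes in W_q F. *)
Definition witt_equiv (q1 q2 : qform) : Prop :=
  exists i j, isometric (qorth q1 (hyperbolic i)) (qorth q2 (hyperbolic j)).

(* <<b_{n-1}, ..., b_1, a]], with bs = [:: b_{n-1}; ...; b_1]. *)
Fixpoint qpfister (bs : seq F) (a : F) : qform :=
  if bs is b :: bs' then qorth (qpfister bs' a) (qscale b (qpfister bs' a))
  else qbinary 1 a.

Definition is_qpfister (n : nat) (q : qform) : Prop :=
  exists bs a, [/\ (size bs).+1 = n, all (fun b => b != 0) bs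
                 & isometric q (qpfister bs a)].

(* A symmetric bilinear form on F^d, given by its Gram matrix. *)
Record bform := BForm { bdim : nat; bmx : 'M[F]_bdim }.

Definition btensor (B1 B2 : bform) : bform := BForm (bmx B1 *t bmx B2).

(* <1, b> *)
Definition bbinary (b : F) : bform :=
  BForm (block_mx 1%:M 0 0 b%:M : 'M[F]_(1 + 1)).

(* <<b_1, ..., b_r>>; the empty product is the form <1>. *)
Definition bpfister (bs : seq F) : bform :=
  foldr (fun b B => btensor (bbinary b) B) (BForm (1%:M : 'M[F]_1)) bs.

(* B (x) q is the quadratic form whose value on a pure tensor v (x) w is
   B(v, v) q(w) and whose polar form is the tensor product of B with the polar
   form of q.  For symmetric B it is represented by the Kronecker product of
   the Gram matrix of B with any matrix representing q. *)
Definition bqtensor (B : bform) (q : qform) : qform := QForm (bmx B *t qmx q).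

Definition separably_linked (k : nat) (q1 q2 : qform) : Prop :=
  exists phi bs1 bs2,
    [/\ is_qpfister k phi,
        all (fun b => b != 0) bs1, all (fun b => b != 0) bs2,
        isometric q1 (bqtensor (bpfister bs1) phi)
      & isometric q2 (bqtensor (bpfister bs2) phi)].

(* The forms whose Witt class lies in I_q^n F, the subgroup of W_q F generated
   by the classes of the scalar multiples of quadratic n-fold Pfister forms. *)
Inductive in_Iq (n : nat) : qform -> Prop :=
| in_Iq_gen c q : c != 0 -> is_qpfister n q -> in_Iq n (qscale c q)
| in_Iq_zero : in_Iq n qzero
| in_Iq_add q1 q2 : in_Iq n q1 -> in_Iq n q2 -> in_Iq n (qorth q1 q2)
| in_Iq_opp q : in_Iq n q -> in_Iq n (qscale (- 1) q)
| in_Iq_witt q1 q2 :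
    in_Iq n q1 -> nonsingular q2 -> witt_equiv q1 q2 -> in_Iq n q2.

Definition Iq_nonzero (n : nat) : Prop :=
  exists2 q, in_Iq n q & ~ witt_equiv q qzero.

Definition Iq_separably_linked (n : nat) : Prop :=
  forall q1 q2, is_qpfister n q1 -> is_qpfister n q2 ->
    separably_linked n.-1 q1 q2.

(* u^n(F) exists and equals u; it fails for every u when the dimensions of
   the anisotropic forms in I_q^n F are unbounded. *)
Definition is_u_invariant (n u : nat) : Prop :=
  (exists q, [/\ in_Iq n q, anisotropic q & qdim q = u]) /\
  (forall q, in_Iq n q -> anisotropic q -> (qdim q <= u)%N).

End QuadraticForms.

Arguments qeval {F} q x.
Arguments qpolar {F} q x y.
Arguments Iq_nonzero : clear implicits.
Arguments Iq_separably_linked : clear implicits.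
Arguments is_u_invariant : clear implicits.

(* Main.v *)
Require Import Defs.
From mathcomp Require Import all_boot all_order all_algebra.
From mathcomp.real_closed Require Import mxtens.
From mathcomp Require Import ring zify.
From Stdlib Require Import Setoid Morphisms Classical.

(** The proof computes in the Witt group, where linkage makes forms shorter:
    linked n-fold Pfister forms are <<b>>u and <<c>>u with u of fold n - 1, and
    since 2u = 0 their sum is bu + cu, of dimension 2^n only.  An anisotropic
    form has the least dimension in its Witt class
    ([anisotropic_witt_dim]), so a form that is Witt equivalent to a
    shorter one is isotropic; for a Pfister form this means hyperbolic
    ([pfister_like_pmul]).

    Both uses of this principle rest on Albert forms
    [1,a+a'] + b[1,a] + d[1,a'], which are Witt equivalent to
    <<b,a]] + <<d,a']].

    - Every (n+2)-fold Pfister form contains an Albert form tensored with an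
      (n-2)-fold bilinear Pfister form.  Linkage shortens this subform, so the
      (n+2)-fold form is hyperbolic ([pfister_hyperbolic]).  Hence
      (n+1)-fold Pfister forms do not change under scaling.

    - For two (n+1)-fold Pfister forms, linkage gives a common factor of fold
      n - 1.  Their pure parts over this factor can be arranged to contain
      together a similar multiple of an Albert form; so they have a common
      value, which is a common slot ([pfister_share]).  Hence the sum of
      two (n+1)-fold Pfister forms is again one ([pfister_sum]).

    It follows that every form in I_q^n is Witt equivalent to pi + psi with pi
    of fold n and psi of fold n + 1 ([in_Iq_decomposition]): a sum of two
    n-fold forms is a multiple of a third, the difference between a form of
    fold n and a multiple of it is of fold n + 1, and that fold is closed
    under addition.  Linkage between pi and a factor of psi shortens pi + psi to
    dimension 2^(n+1) ([pfister_mixed_sum]), which bounds u^n.  The bound is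
    attained as soon as one psi is anisotropic; if all are hyperbolic, every
    form in I_q^n is equivalent to some pi and u^n = 2^n. *)

Set Implicit Arguments.
Unset Strict Implicit.
Unset Printing Implicit Defensive.

Section QuadraticSpaces.

Import GRing.Theory.
Local Open Scope ring_scope.

Variable F : fieldType.
Implicit Types (q : qform F) (a b c t : F).

(** * Isometries *)

Lemma qeval_orth q1 q2 (x : 'rV[F]_(qdim q1)) (y : 'rV[F]_(qdim q2)) :
  qorth q1 q2 (row_mx x y) = q1 x + q2 y.
Proof.
rewrite /qeval /= tr_row_mx mul_row_block !mulmx0 addr0 add0r.
by rewrite mul_row_col mxE.
Qed.

Lemma qeval_scale c q (x : 'rV[F]_(qdim q)) : qscale c q x = c * q x.
Proof. by rewrite /qeval /= -scalemxAr -scalemxAl mxE. Qed.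

Lemma qeval_binary a b (x y : F) :
  qbinary a b (row_mx x%:M y%:M) = a * x ^+ 2 + x * y + b * y ^+ 2.
Proof.
rewrite /qeval /= tr_row_mx !tr_scalar_mx mul_row_block mulmx0 addr0.
rewrite mul_row_col mulmxDl mulmx1 -!scalar_mxM !mxE eqxx !mulr1n.
by ring.
Qed.

Lemma rowP2 (z : 'rV[F]_(1 + 1)) : exists x y, z = row_mx x%:M y%:M.
Proof.
exists (lsubmx z 0 0), (rsubmx z 0 0).
by rewrite -!mx11_scalar hsubmxK.
Qed.

(** With an inverse matrix in hand, sums and compositions of isometries are
    products of (block) matrices; the inverse of a bijective linear map is
    linear, so nothing is lost. *)
Lemma isometricP q1 q2 :
  isometric q1 q2 <-> exists (M : 'M[F]_(qdim q1, qdim q2)) N,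
    [/\ M *m N = 1%:M, N *m M = 1%:M & forall x, q2 (x *m M) = q1 x].
Proof.
split=> [[f [g fK gK] fq] | [M [N [MN NM Mq]]]]; last first.
  exists (mulmxr M) => //=.
  by exists (mulmx^~ N) => x /=; rewrite -mulmxA ?MN ?NM mulmx1.
pose M := lin1_mx f; pose N : 'M_(qdim q2, qdim q1) := \matrix_i g (row i 1%:M).
have NM : N *m M = 1%:M.
  by apply/row_matrixP => i; rewrite row_mul mul_rV_lin1 rowK gK.
have frM : row_free M.
  apply/row_freeP; exists N; apply/row_matrixP => i.
  rewrite row_mul; apply: (can_inj fK); rewrite -!mul_rV_lin1 -/M.
  by rewrite -mulmxA NM mulmx1 -row_mul mul1mx.
exists M, N; split=> // [|x]; last by rewrite mul_rV_lin1.
by apply: (row_free_inj frM); rewrite -mulmxA NM mulmx1 mul1mx.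
Qed.

Lemma isometric_refl q : isometric q q.
Proof.
by apply/isometricP; exists 1%:M, 1%:M; split=> [||x]; rewrite mulmx1.
Qed.

Lemma isometric_sym q1 q2 : isometric q1 q2 -> isometric q2 q1.
Proof.
move=> /isometricP[M [N [MN NM Mq]]]; apply/isometricP; exists N, M.
by split=> // x; rewrite -Mq -mulmxA NM mulmx1.
Qed.

Lemma isometric_trans q2 q1 q3 :
  isometric q1 q2 -> isometric q2 q3 -> isometric q1 q3.
Proof.
move=> /isometricP[M [N [MN NM Mq]]] /isometricP[M' [N' [MN' NM' Mq']]].
apply/isometricP; exists (M *m M'), (N' *m N); split=> [||x].
- by rewrite mulmxA -(mulmxA M) MN' mulmx1.
- by rewrite mulmxA -(mulmxA N') NM mulmx1.
- by rewrite mulmxA Mq' Mq.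
Qed.

Lemma isometric_dim q1 q2 : isometric q1 q2 -> qdim q1 = qdim q2.
Proof.
move=> /isometricP[M [N [MN NM _]]]; apply/eqP; rewrite eqn_leq.
by rewrite (mulmx1_min MN) (mulmx1_min NM).
Qed.

Lemma isometric_orth q1 q1' q2 q2' :
  isometric q1 q1' -> isometric q2 q2' ->
  isometric (qorth q1 q2) (qorth q1' q2').
Proof.
move=> /isometricP[M [N [MN NM Mq]]] /isometricP[M' [N' [MN' NM' Mq']]].
apply/isometricP; exists (block_mx M 0 0 M'), (block_mx N 0 0 N').
split=> [||x].
- by rewrite mulmx_block !(mulmx0, mul0mx, addr0, add0r) MN MN'
  -scalar_mx_block.
- by rewrite mulmx_block !(mulmx0, mul0mx, addr0, add0r) NM NM'
  -scalar_mx_block.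
- rewrite -[x]hsubmxK mul_row_block !mulmx0 addr0 add0r.
  by rewrite !qeval_orth Mq Mq'.
Qed.

Lemma isometric_scale c q1 q2 :
  isometric q1 q2 -> isometric (qscale c q1) (qscale c q2).
Proof.
move=> /isometricP[M [N [MN NM Mq]]]; apply/isometricP; exists M, N.
by split=> // x; rewrite !qeval_scale Mq.
Qed.

Lemma isometric_orthC q1 q2 : isometric (qorth q1 q2) (qorth q2 q1).
Proof.
apply/isometricP; exists (block_mx 0 1%:M 1%:M 0), (block_mx 0 1%:M 1%:M 0).
split=> [||x].
- by rewrite mulmx_block !(mulmx0, mul0mx, addr0, add0r, mulmx1)
  -scalar_mx_block.
- by rewrite mulmx_block !(mulmx0, mul0mx, addr0, add0r, mulmx1)
  -scalar_mx_block.
- rewrite -[x]hsubmxK mul_row_block !mulmx0 !mulmx1 addr0 add0r.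
  by rewrite !qeval_orth addrC.
Qed.

(** Forms whose coordinate systems differ by an arithmetic identity between
    dimensions, as for associativity of sums and for Kronecker products, are
    compared by this renaming. *)
Lemma isometric_reindex q1 q2 (f : 'I_(qdim q1) -> 'I_(qdim q2)) g :
  cancel f g -> cancel g f ->
  (forall i j, qmx q2 (f i) (f j) = qmx q1 i j) -> isometric q1 q2.
Proof.
move=> fK gK fq; apply/isometricP.
pose M : 'M[F]_(qdim q1, qdim q2) := \matrix_(i, j) (f i == j)%:R.
pose N : 'M[F]_(qdim q2, qdim q1) := \matrix_(i, j) (g i == j)%:R.
have mulM m (A : 'M[F]_(qdim q2, m)) : M *m A = \matrix_(i, j) A (f i) j.
  apply/matrixP => i j; rewrite !mxE (bigD1 (f i)) //= big1 ?addr0.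
    by rewrite mxE eqxx mul1r.
  by move=> k kf; rewrite mxE eq_sym (negPf kf) mul0r.
have mulN m (A : 'M[F]_(qdim q1, m)) : N *m A = \matrix_(i, j) A (g i) j.
  apply/matrixP => i j; rewrite !mxE (bigD1 (g i)) //= big1 ?addr0.
    by rewrite mxE eqxx mul1r.
  by move=> k kf; rewrite mxE eq_sym (negPf kf) mul0r.
exists M, N; split=> [||x].
- by rewrite mulM; apply/matrixP => i j; rewrite !mxE fK.
- by rewrite mulN; apply/matrixP => i j; rewrite !mxE gK.
- rewrite /qeval trmx_mul; congr (_ 0 0); rewrite !mulmxA; congr (_ *m _).
  rewrite -!mulmxA; congr (_ *m _); rewrite mulM.
  apply/matrixP => i j; rewrite !mxE (bigD1 (f j)) //= big1 ?addr0.
    by rewrite !mxE eqxx mulr1 fq.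
  by move=> k kf; rewrite !mxE eq_sym (negPf kf) mulr0.
Qed.

Lemma isometric_orthA q1 q2 q3 :
  isometric (qorth (qorth q1 q2) q3) (qorth q1 (qorth q2 q3)).
Proof.
pose f := cast_ord (esym (addnA (qdim q1) (qdim q2) (qdim q3))).
pose g := cast_ord (addnA (qdim q1) (qdim q2) (qdim q3)).
apply: (@isometric_reindex (qorth (qorth q1 q2) q3)
  (qorth q1 (qorth q2 q3)) f g).
- exact: cast_ordKV.
- exact: cast_ordK.
- move=> i j; have := @block_mxA F _ _ _ _ _ _ (qmx q1) 0 0 0 (qmx q2) 0 0 0
  (qmx q3).
  rewrite !row_mx0 !col_mx0 => E.
  rewrite /= in E; rewrite /= E castmxE.
  by congr (block_mx _ _ _ _ _ _); apply: val_inj.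
Qed.

Lemma isometric_orth0 q : isometric (qorth q (qzero F)) q.
Proof.
pose f := cast_ord (addn0 (qdim q)).
pose g := cast_ord (esym (addn0 (qdim q))).
apply: (@isometric_reindex (qorth q (qzero F)) q f g).
- exact: cast_ordK.
- exact: cast_ordKV.
- move=> i j; rewrite -[i](@cast_ordK _ _ (addn0 _)) -[j](@cast_ordK _ _ (addn0
  _)).
  rewrite -/f.
  have lE k : cast_ord (esym (addn0 (qdim q))) k = lshift 0 k by apply: val_inj.
  by rewrite !lE /= block_mxEul; congr (qmx q _ _); apply: val_inj.
Qed.

(** * Witt equivalence and dimension *)

Definition totally_isotropic m q (W : 'M[F]_(m, qdim q)) : Prop :=
  forall x, q (x *m W) = 0.

(** The subspace is given by spanning rows, its dimension being a rank, so that
    images and kernels never call for a choice of basis. *)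
Definition has_isotropic_space k q : Prop :=
  exists m (W : 'M[F]_(m, qdim q)), (k <= \rank W)%N /\ totally_isotropic W.

Lemma has_isotropic_space_isometric k q1 q2 :
  isometric q1 q2 -> has_isotropic_space k q1 -> has_isotropic_space k q2.
Proof.
move=> /isometricP[M [N [MN NM Mq]]] [m [W [rW W0]]].
exists m, (W *m M); split=> [|x]; last by rewrite mulmxA Mq.
by apply: (leq_trans rW); rewrite -{1}[W]mulmx1 -MN mulmxA mxrankM_maxl.
Qed.

(** Let (e, f) be the basis of the hyperbolic plane.  Cut the isotropic space W
    down to the vectors without f-coordinate and project them to q: there they
    stay isotropic.  If W lies in the hyperplane orthogonal to e, only e can be
    lost in the projection.  Otherwise the cut costs one dimension, but then e
    is not in W, as it is polar to some element of W. *)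
Lemma has_isotropic_space_cancel k q :
  has_isotropic_space k.+1 (qorth (qbinary 0 0) q) -> has_isotropic_space k q.
Proof.
move=> [m [W [rW W0]]].
pose We : 'M[F]_(m, 1) := lsubmx (lsubmx W).
pose Wf : 'M[F]_(m, 1) := rsubmx (lsubmx W).
pose Wq : 'M[F]_(m, qdim q) := rsubmx W.
have defW : W = row_mx (row_mx We Wf) Wq by rewrite !hsubmxK.
have evalW x : (x *m We) 0 0 * (x *m Wf) 0 0 + q (x *m Wq) = 0.
  have := W0 x; rewrite defW !mul_mx_row qeval_orth.
  rewrite [x *m We]mx11_scalar [x *m Wf]mx11_scalar qeval_binary.
  by rewrite !mul0r addr0 add0r !mxE eqxx !mulr1n.
have ti (K : 'M[F]_m) : K *m Wf = 0 -> totally_isotropic (K *m Wq).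
  move=> K0 x; have := evalW (x *m K).
  by rewrite -(mulmxA x K Wf) K0 mulmx0 [_ 0 0 in X in _ * X]mxE mulr0 add0r
    mulmxA.
case: (eqVneq Wf 0) => [Wf0 | Wf_n0].
  exists m, Wq; split; last by rewrite -[Wq]mul1mx; apply: ti; rewrite mul1mx.
  have : (\rank W <= 1 + \rank Wq)%N.
    rewrite {1}defW Wf0 -mxrank_tr tr_row_mx -addsmxE.
    apply: leq_trans (mxrank_adds_leqif _ _).1 _.
    rewrite !mxrank_tr leq_add2r -mxrank_tr tr_row_mx -addsmxE trmx0 addsmx0.
    by rewrite mxrank_tr rank_leq_col.
  by move=> /(leq_trans rW); rewrite add1n ltnS.
pose K := kermx Wf.
exists m, (K *m Wq); split; last by apply: ti; apply: mulmx_ker.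
have rK : (m <= \rank K + 1)%N.
  by rewrite mxrank_ker; have := rank_leq_col Wf; have := rank_leq_row Wf; lia.
(* Evaluating at the sum of x W and a row of W with nonzero f-coordinate shows
   that x W, a multiple of e, is zero. *)
have kerW (x : 'rV[F]_m) : x *m Wf = 0 -> x *m Wq = 0 -> x *m W = 0.
  move=> xf xq; suff xe : x *m We = 0.
    by rewrite defW !mul_mx_row xe xf xq !row_mx0.
  have [i Wfi] : exists i, Wf i 0 != 0.
    apply/existsP; apply: contraNT Wf_n0; rewrite negb_exists => /forallP Wf0.
    apply/eqP/matrixP => i j; rewrite ord1 [RHS]mxE; apply/eqP.
    by move: (Wf0 i); rewrite negbK.
  have := evalW (delta_mx 0 i + x); rewrite !mulmxDl xf xq !addr0 -!rowE.
  rewrite [((_ + _) : 'M_(_, _)) 0 0]mxE mulrDl -addrA [_ * _ + q _]addrC addrA.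
  rewrite !rowE evalW add0r -rowE => /eqP.
  rewrite [row _ _ _ _]mxE mulf_eq0 (negPf Wfi) orbF => /eqP xe0.
  by rewrite [x *m We]mx11_scalar xe0 raddf0.
have rKW : \rank (K *m W) = \rank (K *m Wq).
  apply/eqP; rewrite eqn_leq; apply/andP; split; last first.
    have -> : K *m Wq = K *m W *m col_mx 0 1%:M.
      by rewrite -mulmxA [X in X *m col_mx _ _]defW mul_row_col mulmx0 add0r
        mulmx1.
    exact: mxrankM_maxl.
  have sub : (kermx (K *m Wq) <= kermx (K *m W))%MS.
    apply/row_subP => i; apply/sub_kermxP; rewrite mulmxA; apply: kerW.
      by rewrite -mulmxA mulmx_ker mulmx0.
    by rewrite -mulmxA; apply/sub_kermxP; rewrite row_sub.
  have := mxrankS sub; rewrite !mxrank_ker.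
  by have := rank_leq_row (K *m W); have := rank_leq_row (K *m Wq); lia.
rewrite -rKW; have := mxrank_mul_ker K W.
have : (\rank (K :&: kermx W)%MS <= \rank (kermx W))%N by rewrite mxrankS
  ?capmxSr.
by rewrite mxrank_ker; have := rank_leq_row W; lia.
Qed.

Lemma has_isotropic_space_hyperbolic k i q :
  has_isotropic_space (k + i) (qorth q (hyperbolic F i)) ->
  has_isotropic_space k q.
Proof.
elim: i k => [|i IHi] k.
  rewrite addn0; apply: has_isotropic_space_isometric.
  exact: isometric_orth0.
rewrite addnS => H; apply: IHi; apply: has_isotropic_space_cancel.
apply: has_isotropic_space_isometric H.
apply: isometric_trans (isometric_orth (isometric_refl _)
  (isometric_orthC _ _)) _.
apply: isometric_trans (isometric_sym (isometric_orthA _ _ _)) _.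
exact: isometric_orthC.
Qed.

Lemma hyperbolic_has_isotropic_space i q :
  has_isotropic_space i (qorth q (hyperbolic F i)).
Proof.
elim: i => [|i [m [W [rW W0]]]].
  exists 0%N, 0; split=> // x.
  by rewrite mulmx0 /qeval !mul0mx mxE.
suff: has_isotropic_space i.+1 (qorth (qbinary 0 0) (qorth q (hyperbolic F i))).
  apply: has_isotropic_space_isometric.
  apply: isometric_trans (isometric_sym (isometric_orthA _ _ _)) _.
  apply: isometric_trans (isometric_orth (isometric_orthC _ _)
    (isometric_refl _)) _.
  exact: isometric_orthA.
exists (1 + m)%N, (block_mx (row_mx 1%:M 0) 0 0 W); split.
  rewrite rank_diag_block_mx -add1n; apply: leq_add => //.
  have /eqP -> // : row_free (row_mx 1%:M 0 : 'M[F]_(1, 1 + 1)).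
  by apply/row_freeP; exists (col_mx 1%:M 0);
    rewrite mul_row_col mulmx0 addr0 mulmx1.
move=> x; rewrite -[x]hsubmxK mul_row_block !mulmx0 addr0 add0r.
rewrite qeval_orth W0 addr0 mul_mx_row mulmx0 mulmx1.
rewrite [lsubmx x]mx11_scalar -[X in row_mx _ X](raddf0 (@scalar_mx _ 1)).
by rewrite qeval_binary !mul0r mulr0 !addr0.
Qed.

Lemma anisotropic_isotropic_space k q :
  anisotropic q -> has_isotropic_space k q -> k = 0%N.
Proof.
move=> q_an [m [W [rW W0]]]; apply/eqP; rewrite -leqn0; apply: leq_trans rW _.
rewrite leqn0 mxrank_eq0; apply/eqP/row_matrixP => i.
rewrite row0 rowE; apply/eqP/negPn/negP => /q_an.
by rewrite W0 eqxx.
Qed.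

Lemma qdim_hyperbolic i : qdim (hyperbolic F i) = i.*2.
Proof. by elim: i => //= i ->; rewrite doubleS. Qed.

(** If q1 + iH = q2 + jH with H hyperbolic, the right side has an isotropic
    space of dimension j, whereas removing i hyperbolic planes from the left
    side leaves an anisotropic form, so that j <= i. *)
Lemma anisotropic_witt_dim q1 q2 :
  anisotropic q1 -> witt_equiv q1 q2 -> (qdim q1 <= qdim q2)%N.
Proof.
move=> q1_an [i [j q12]].
have := isometric_dim q12; rewrite /= !qdim_hyperbolic.
have [le_ji|lt_ij] := leqP j i; first by lia.
have := hyperbolic_has_isotropic_space j q2.
move/(has_isotropic_space_isometric (isometric_sym q12)).
rewrite -(subnK (ltnW lt_ij)) => /has_isotropic_space_hyperbolic.
by move/(anisotropic_isotropic_space q1_an)/eqP; rewrite subn_eq0 leqNgt lt_ij.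
Qed.

Lemma isometric_hyperbolicD q i k :
  isometric (qorth q (hyperbolic F (i + k)))
            (qorth (qorth q (hyperbolic F i)) (hyperbolic F k)).
Proof.
apply: isometric_trans (isometric_sym (isometric_orthA _ _ _)).
apply: isometric_orth; first exact: isometric_refl.
elim: i => [|i IHi] /=.
  apply: isometric_trans (isometric_orthC _ _); apply: isometric_sym.
  exact: isometric_orth0.
apply: isometric_trans (isometric_sym (isometric_orthA _ _ _)).
by apply: isometric_orth => //; apply: isometric_refl.
Qed.

Lemma isometric_orthAC q1 q2 q3 :
  isometric (qorth (qorth q1 q2) q3) (qorth (qorth q1 q3) q2).
Proof.
apply: isometric_trans (isometric_orthA _ _ _) _.
apply: isometric_trans (isometric_sym (isometric_orthA _ _ _)).
by apply: isometric_orth; [apply: isometric_refl | apply: isometric_orthC].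
Qed.

Lemma isometric_witt q1 q2 : isometric q1 q2 -> witt_equiv q1 q2.
Proof.
by move=> q12; exists 0%N, 0%N; apply: isometric_orth => //;
  apply: isometric_refl.
Qed.

Lemma witt_refl q : witt_equiv q q.
Proof. exact/isometric_witt/isometric_refl. Qed.

Lemma witt_sym q1 q2 : witt_equiv q1 q2 -> witt_equiv q2 q1.
Proof. by move=> [i [j q12]]; exists j, i; apply: isometric_sym. Qed.

Lemma witt_trans q2 q1 q3 :
  witt_equiv q1 q2 -> witt_equiv q2 q3 -> witt_equiv q1 q3.
Proof.
move=> [i [j q12]] [k [l q23]]; exists (i + k)%N, (l + j)%N.
apply: isometric_trans (isometric_hyperbolicD _ _ _) _.
apply: isometric_trans (isometric_sym (isometric_hyperbolicD _ _ _)).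
apply: isometric_trans (isometric_orth q12 (isometric_refl _)) _.
apply: isometric_trans (isometric_orthAC _ _ _) _.
by apply: isometric_orth => //; apply: isometric_refl.
Qed.

Lemma witt_orth q1 q1' q2 q2' :
  witt_equiv q1 q1' -> witt_equiv q2 q2' ->
  witt_equiv (qorth q1 q2) (qorth q1' q2').
Proof.
have orthr q q3 q3' : witt_equiv q3 q3' ->
  witt_equiv (qorth q3 q) (qorth q3' q).
  move=> [i [j q33']]; exists i, j.
  apply: isometric_trans (isometric_orthAC _ _ _) _.
  apply: isometric_trans (isometric_orthAC _ _ _).
  by apply: isometric_orth => //; apply: isometric_refl.
move=> q11' q22'; apply: witt_trans (orthr q2 _ _ q11') _.
apply: witt_trans (isometric_witt (isometric_orthC _ _)) _.
apply: witt_trans (orthr q1' _ _ q22') _.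
exact/isometric_witt/isometric_orthC.
Qed.

(** In characteristic 2 the polar form of [a,b] is the determinant, so each
    basis of determinant 1 shows the same form with new coefficients. *)
Lemma isometric_binary (char2 : 1 + 1 = 0 :> F) a b (x y x' y' : F) :
  x * y' + y * x' = 1 ->
  isometric (qbinary (a * x ^+ 2 + x * y + b * y ^+ 2)
                     (a * x' ^+ 2 + x' * y' + b * y' ^+ 2)) (qbinary a b).
Proof.
move=> det1; apply/isometricP.
exists (block_mx x%:M y%:M x'%:M y'%:M), (block_mx y'%:M y%:M x'%:M x%:M).
have block1 (p q r s : F) : p = 1 -> q = 0 -> r = 0 -> s = 1 ->
    block_mx p%:M q%:M r%:M s%:M = 1%:M :> 'M_(1 + 1).
  by move=> -> -> -> ->; rewrite raddf0 -scalar_mx_block.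
split=> [||z].
- by rewrite mulmx_block -!scalar_mxM -!raddfD block1 // -?det1; ring: char2.
- by rewrite mulmx_block -!scalar_mxM -!raddfD block1 // -?det1; ring: char2.
have [u [v ->]] := rowP2 z.
rewrite mul_row_block -!scalar_mxM -!raddfD !qeval_binary.
by rewrite -[u * v]mulr1 -det1; ring: char2.
Qed.

Lemma isometric_binary_scale c a b :
  c != 0 -> isometric (qscale c (qbinary a b)) (qbinary (c * a) (b / c)).
Proof.
move=> c0; apply/isometricP.
exists (block_mx 1%:M 0 0 c%:M), (block_mx 1%:M 0 0 c^-1%:M).
split=> [||z].
- rewrite mulmx_block !(mulmx0, mul0mx, addr0, add0r) mulmx1 -scalar_mxM.
  by rewrite divff // -scalar_mx_block.
- rewrite mulmx_block !(mulmx0, mul0mx, addr0, add0r) mulmx1 -scalar_mxM.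
  by rewrite mulVf // -scalar_mx_block.
have [u [v ->]] := rowP2 z.
rewrite mul_row_block !mulmx0 addr0 add0r mulmx1 -scalar_mxM.
by rewrite qeval_scale !qeval_binary; field.
Qed.

(** The transvection e1 |-> e1 + t e2, f2 |-> f2 + t f1; it is an involution. *)
Lemma isometric_binary2 (char2 : 1 + 1 = 0 :> F) a b c d t :
  isometric (qorth (qbinary (a + c * t ^+ 2) b) (qbinary c (d + b * t ^+ 2)))
            (qorth (qbinary a b) (qbinary c d)).
Proof.
pose T : 'M[F]_(1 + 1) := block_mx t%:M 0 0 0.
pose T' : 'M[F]_(1 + 1) := block_mx 0 0 0 t%:M.
pose M := block_mx 1%:M T T' 1%:M.
have dblM m n (A : 'M[F]_(m, n)) : A + A = 0.
  by apply/matrixP => i j; rewrite !mxE; ring: char2.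
have MM : M *m M = 1%:M.
  rewrite mulmx_block !mulmx1 !mul1mx !dblM !mulmx_block.
  rewrite !(mulmx0, mul0mx, addr0, add0r) !block_mx0 ?addr0 ?add0r.
  by rewrite -scalar_mx_block.
apply/isometricP; exists M, M; split=> // z.
rewrite -[z]hsubmxK; have [x1 [y1 ->]] := rowP2 (lsubmx z).
have [x2 [y2 ->]] := rowP2 (rsubmx z).
rewrite mul_row_block !mulmx1 !mul_row_block !(mulmx0, addr0, add0r).
rewrite !add_row_mx !addr0 !add0r -!scalar_mxM -!raddfD.
by rewrite !qeval_orth !qeval_binary; ring: char2.
Qed.

End QuadraticSpaces.

Section WittClasses.

Import GRing.Theory.
Local Open Scope ring_scope.

Variable F : fieldType.
Hypothesis char2 : 1 + 1 = 0 :> F.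

Lemma addrr2 (x : F) : x + x = 0.
Proof. by rewrite -[x]mulr1 -mulrDr char2 mulr0. Qed.

(** * Witt classes of sums of binary forms *)

(** The pair (a, b) stands for [a,b] and a list for an orthogonal sum.  Sums,
    scalings and reorderings become operations on lists, and half the dimension
    becomes the size. *)
Definition form := seq (F * F).
Implicit Types (s t u : form) (a b c d e : F).

Fixpoint qf s : qform F :=
  if s is p :: s' then qorth (qbinary p.1 p.2) (qf s') else qzero F.

Definition scale c s : form := [seq (c * p.1, p.2 / c) | p <- s].

Lemma scaleA c d s : scale c (scale d s) = scale (c * d) s.
Proof.
rewrite /scale -map_comp; apply: eq_map => p /=.
by congr (_, _); rewrite ?invfM; ring.
Qed.

Lemma scaleC c d s : scale c (scale d s) = scale d (scale c s).
Proof. by rewrite !scaleA mulrC. Qed.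

Lemma scale_cat c s t : scale c (s ++ t) = scale c s ++ scale c t.
Proof. exact: map_cat. Qed.

Lemma size_scale c s : size (scale c s) = size s.
Proof. exact: size_map. Qed.

Lemma qdim_qf s : qdim (qf s) = (size s).*2.
Proof. by elim: s => //= p s ->; rewrite doubleS. Qed.

Lemma qf_cat s t : isometric (qf (s ++ t)) (qorth (qf s) (qf t)).
Proof.
elim: s => [|p s IHs] /=.
  apply: isometric_trans (isometric_orthC _ _); apply: isometric_sym.
  exact: isometric_orth0.
apply: isometric_trans (isometric_sym (isometric_orthA _ _ _)).
exact: isometric_orth (isometric_refl _) IHs.
Qed.

Lemma qf_perm s t : perm_eq s t -> isometric (qf s) (qf t).
Proof.
move=> st; pose P u := isometric (qf s) (qf u).
apply: (catCA_perm_ind (P := P) _ st); last exact: isometric_refl.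
move=> s1 s2 s3 H; apply: isometric_trans H _.
apply: isometric_trans (qf_cat _ _) _.
apply: isometric_trans (isometric_orth (isometric_refl _) (qf_cat _ _)) _.
apply: isometric_trans (isometric_sym (isometric_orthA _ _ _)) _.
apply: isometric_trans (isometric_orth (isometric_orthC _ _)
  (isometric_refl _)) _.
apply: isometric_trans (isometric_orthA _ _ _) _.
apply: isometric_sym; apply: isometric_trans (qf_cat _ _) _.
exact: isometric_orth (isometric_refl _) (qf_cat _ _).
Qed.

Lemma qscale_orth c (q1 q2 : qform F) :
  qscale c (qorth q1 q2) = qorth (qscale c q1) (qscale c q2).
Proof. by rewrite /qscale /qorth /= scale_block_mx !scaler0. Qed.

Lemma qscale1 (q : qform F) : qscale 1 q = q.
Proof. by case: q => d A; rewrite /qscale scale1r. Qed.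

Lemma qscale_zero c : qscale c (qzero F) = qzero F.
Proof. by rewrite /qscale /= scaler0. Qed.

Lemma qf_scale c s : c != 0 -> isometric (qf (scale c s)) (qscale c (qf s)).
Proof.
move=> c0; elim: s => [|p s IHs] /=.
  by rewrite qscale_zero; apply: isometric_refl.
rewrite qscale_orth; apply: isometric_orth IHs.
exact/isometric_sym/isometric_binary_scale.
Qed.

Lemma qf_hyperbolic i : qf (nseq i (0, 0)) = hyperbolic F i.
Proof. by elim: i => //= i ->. Qed.

Definition weq s t := witt_equiv (qf s) (qf t).
Local Notation "s ~ t" := (weq s t) (at level 70).

Lemma weq_refl s : s ~ s. Proof. exact: witt_refl. Qed.
#[local] Hint Resolve weq_refl : core.
Lemma weq_sym s t : s ~ t -> t ~ s. Proof. exact: witt_sym. Qed.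
Lemma weq_trans t s u : s ~ t -> t ~ u -> s ~ u.
Proof. exact: witt_trans. Qed.

#[local] Instance weq_equivalence : Equivalence weq.
Proof.
by split; [exact: weq_refl | exact: weq_sym | move=> s t u; exact: weq_trans].
Qed.

Lemma weq_cat s s' t t' : s ~ s' -> t ~ t' -> s ++ t ~ s' ++ t'.
Proof.
move=> ss' tt'; apply: witt_trans (isometric_witt (qf_cat _ _)) _.
apply: witt_trans (isometric_witt (isometric_sym (qf_cat _ _))).
exact: witt_orth.
Qed.

#[local] Instance cat_proper : Proper (weq ==> weq ==> weq) (@cat (F * F)).
Proof. by move=> s s' ss' t t' tt'; apply: weq_cat. Qed.

Lemma weq_perm s t : perm_eq s t -> s ~ t.
Proof. by move=> /qf_perm/isometric_witt. Qed.

(** Multisets of entries are compared through their counting functions, which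
    turns a reordering of summands into a linear identity between naturals. *)
Ltac same_entries :=
  apply/weq_perm/permP; let P := fresh "P" in intro P;
  rewrite /= ?count_cat /=; ring.

Lemma weq_scale c s t : c != 0 -> s ~ t -> scale c s ~ scale c t.
Proof.
move=> c0 [i [j st]]; exists i, j.
have sc u k :
    isometric (qorth (qf (scale c u)) (hyperbolic F k))
              (qscale c (qorth (qf u) (hyperbolic F k))).
  rewrite qscale_orth; apply: isometric_orth; first exact: qf_scale.
  have := @qf_scale c (nseq k (0, 0)) c0.
  by rewrite /scale map_nseq /= mulr0 mul0r qf_hyperbolic.
apply: isometric_trans (sc _ _) _;
  apply: isometric_trans (isometric_sym (sc _ _)).
exact: isometric_scale.
Qed.

Lemma weq_hyperbolic i : nseq i (0, 0) ~ [::].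
Proof.
exists 0%N, i; rewrite qf_hyperbolic.
apply: isometric_trans (isometric_orth0 _) _.
apply: isometric_trans (isometric_orthC _ _).
exact/isometric_sym/isometric_orth0.
Qed.

Lemma weq_binary a b (x y x' y' : F) : x * y' + y * x' = 1 ->
  [:: (a * x ^+ 2 + x * y + b * y ^+ 2, a * x' ^+ 2 + x' * y' + b * y' ^+ 2)]
  ~ [:: (a, b)].
Proof.
move=> det1; apply: isometric_witt.
by apply: isometric_orth; [apply: isometric_binary | apply: isometric_refl].
Qed.

Lemma weq_binary2 a b c d (e : F) :
  [:: (a + c * e ^+ 2, b); (c, d + b * e ^+ 2)] ~ [:: (a, b); (c, d)].
Proof.
apply: isometric_witt; rewrite /=.
apply: isometric_trans (isometric_sym (isometric_orthA _ _ _)) _.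
apply: isometric_trans (isometric_orthA _ _ _).
by apply: isometric_orth; [apply: isometric_binary2 | apply: isometric_refl].
Qed.

Lemma weq_swap a b : [:: (a, b)] ~ [:: (b, a)].
Proof.
have := @weq_binary b a 0 1 1 0; rewrite !(expr0n, mulr0, mul0r, expr1n, mulr1).
by rewrite !(addr0, add0r); apply.
Qed.

Lemma weq_square a b c : c != 0 -> [:: (a * c ^+ 2, b / c ^+ 2)] ~ [:: (a, b)].
Proof.
move=> c0; have := @weq_binary a b c 0 0 c^-1.
rewrite !(expr0n, mulr0, mul0r, addr0, add0r) divff // exprVn.
by apply.
Qed.

Lemma weq_isotropic b : [:: (0, b)] ~ [::].
Proof.
have := @weq_binary 0 b 1 0 b 1.
rewrite !(expr0n, expr1n, mulr0, mul0r, mulr1, addr0, add0r).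
rewrite addrr2 => E.
by rewrite -E //; apply: (weq_hyperbolic 1).
Qed.

(** Applied to two copies of a plane [a,b], the transvection leaves the
    isotropic planes [0,b] and [a,0]. *)
Lemma weq_double s : s ++ s ~ [::].
Proof.
elim: s => [|[a b] s IHs]; first exact: weq_refl.
apply: (@weq_trans ([:: (a, b); (a, b)] ++ (s ++ s))).
  by same_entries.
rewrite IHs cats0 -(weq_binary2 a b a b 1) expr1n !mulr1.
rewrite !addrr2.
rewrite -[[:: _; _]]/([:: _] ++ [:: _]) weq_isotropic weq_swap.
exact: weq_isotropic.
Qed.

Lemma weq_cancel s t : s ++ t ++ t ~ s.
Proof. by rewrite weq_double cats0. Qed.

Lemma weq_add0 s t : s ++ t ~ [::] -> s ~ t.
Proof. by move=> st; rewrite -(weq_cancel s t) catA st. Qed.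

(** Additivity of the Arf invariant.  With the coefficients swapped, the
    transvection makes one of the planes isotropic. *)
Lemma weq_arf a b : [:: (1, a); (1, b)] ~ [:: (1, a + b)].
Proof.
have E x y : [:: (x, 1); (y, 1)] ~ [:: (1, x); (1, y)].
  by rewrite -[[:: (x, 1); _]]/([:: (x, 1)] ++ [:: (y, 1)])
             weq_swap (weq_swap y).
rewrite -E -(weq_binary2 a 1 b 1 1) expr1n !mulr1 char2.
rewrite -[[:: _; _]]/([:: _] ++ [:: _]) (weq_swap b) weq_isotropic cats0.
exact: weq_swap.
Qed.

Lemma weq_scale_square c s : c != 0 -> scale (c * c) s ~ s.
Proof.
move=> c0; elim: s => [|[a b] s IHs] //=.
rewrite -cat1s IHs -[X in _ ~ X]cat1s; apply: weq_cat => //.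
by rewrite -(weq_square a b c0) expr2 [a * _]mulrC.
Qed.

(** The relation <x> + <y> = <x+y> + <xy(x+y)> of the bilinear Witt ring, acting
    on quadratic forms.  On one plane it is a composition of two transvections:
    the first makes x a into (x+y) a, the second corrects b/x to b/(x+y). *)
Lemma weq_add_scale (x y : F) s : x != 0 -> y != 0 -> x + y != 0 ->
  scale x s ++ scale y s ~ scale (x + y) (s ++ scale (x * y) s).
Proof.
move=> x0 y0 xy0; elim: s => [|[a b] s IHs]; first exact: weq_refl.
apply: (@weq_trans ([:: (x * a, b / x); (y * a, b / y)] ++
                    (scale x s ++ scale y s))).
  by same_entries.
rewrite IHs.
apply: (@weq_trans ([:: ((x + y) * a, b / (x + y));
    ((x + y) * (x * y * a), b / (x * y) / (x + y))] ++
    (scale (x + y) (s ++ scale (x * y) s)))); last first.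
  by rewrite !scale_cat; same_entries.
apply: weq_cat => //.
apply: (@weq_trans [:: ((x + y) * a, b / x); (y * a, b * (x + y) / (x * y))]).
  rewrite -(weq_binary2 (x * a) (b / x) (y * a) (b / y) 1) expr1n !mulr1.
  rewrite -mulrDl (_ : b / y + b / x = b * (x + y) / (x * y)) //.
  by field; rewrite ?x0 ?y0 ?xy0.
have swap2 (p q p' q' : F) : [:: (p, q); (p', q')] ~ [:: (q, p); (q', p')].
  by rewrite -[[:: (p, q); _]]/([:: _] ++ [:: _]) weq_swap (weq_swap p').
rewrite swap2 -(weq_binary2 _ _ _ _ (y / (x + y))) swap2.
rewrite -[X in X ~ _]/([:: _] ++ [:: _]) -[X in _ ~ X]/([:: _] ++ [:: _]).
have -> : b / x + b * (x + y) / (x * y) * (y / (x + y)) ^+ 2 = b / (x + y).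
  rewrite -[RHS]addr0 -(addrr2 (b * y / (x * (x + y)))).
  by field; rewrite ?x0 ?y0 ?xy0.
apply: weq_cat => //; rewrite -(weq_square (y * a + _) _ xy0).
have -> : y * a + (x + y) * a * (y / (x + y)) ^+ 2 = x * y * a / (x + y).
  rewrite -[RHS]addr0 -(addrr2 (a * y ^+ 2 / (x + y))).
  by field.
rewrite (_ : _ / _ * _ = (x + y) * (x * y * a)); last by field.
rewrite (_ : _ / _ / _ = b / (x * y) / (x + y)) //.
by field; rewrite ?x0 ?y0 ?xy0.
Qed.

(** * Values of forms *)

(** The form s takes the value c at some vector, which is nonzero iff z holds.
    The flag makes one relation serve for values and for isotropy. *)
Inductive rep : form -> bool -> F -> Prop :=
| rep_nil : rep [::] false 0
| rep_cons a b x y s z c : rep s z c ->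
    rep ((a, b) :: s) (((x, y) != (0, 0)) || z)
        (a * x ^+ 2 + x * y + b * y ^+ 2 + c).

Definition isotropic s := rep s true 0.

Lemma rep_consE p s z c : rep (p :: s) z c -> exists x y z' c',
  [/\ rep s z' c', z = ((x, y) != (0, 0)) || z' &
      c = p.1 * x ^+ 2 + x * y + p.2 * y ^+ 2 + c'].
Proof.
move E: (p :: s) => s' H; case: H E => // a b x y s0 z' c' H [-> ->].
by exists x, y, z', c'.
Qed.

Lemma rep_nilE z c : rep [::] z c -> z = false /\ c = 0.
Proof. by move E: [::] => s' H; case: H E. Qed.

Lemma rep_zero s : rep s false 0.
Proof.
elim: s => [|[a b] s IHs]; first exact: rep_nil.
have := rep_cons a b 0 0 IHs.
by rewrite !expr0n !mulr0 !addr0 eqxx.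
Qed.

Lemma rep_false s c : rep s false c -> c = 0.
Proof.
elim: s c => [|p s IHs] c; first by case/rep_nilE.
case/rep_consE => x [y [z' [c' [H /esym/negbT]]]].
rewrite negb_or negbK => /andP[/eqP[-> ->] /negPf z'F] ->.
by rewrite z'F in H; rewrite (IHs _ H) !expr0n !mulr0 !addr0.
Qed.

Lemma rep_cat s t z z' c c' : rep s z c -> rep t z' c' ->
  rep (s ++ t) (z || z') (c + c').
Proof.
move=> H H'; elim: H => [|a b x y s' z0 c0 _ IH] /=; first by rewrite add0r.
by rewrite -orbA -addrA; apply: rep_cons.
Qed.

Lemma rep_catE s t z c : rep (s ++ t) z c -> exists z1 z2 c1 c2,
  [/\ rep s z1 c1, rep t z2 c2, z = z1 || z2 & c = c1 + c2].
Proof.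
elim: s z c => [|[a b] s IHs] z c /=.
  by exists false, z, 0, c; split=> //; [exact: rep_nil | rewrite add0r].
case/rep_consE => x [y [z' [c' [/IHs[z1 [z2 [c1 [c2 [H1 H2 -> ->]]]]] -> ->]]]].
exists (((x, y) != (0, 0)) || z1), z2; do 2!eexists.
by split; [apply: rep_cons H1 | exact: H2 | rewrite orbA | rewrite addrA].
Qed.

Lemma rep_scaleE d s z c : d != 0 -> rep (scale d s) z c ->
  exists2 c', rep s z c' & c = d * c'.
Proof.
move=> d0; elim: s z c => [|[a b] s IHs] z c /=.
  by case/rep_nilE => -> ->; exists 0; [exact: rep_nil | rewrite mulr0].
case/rep_consE => x [y [z' [c' [/IHs[c1 H1 ->] -> ->]]]] /=.
exists (a * x ^+ 2 + x * (y / d) + b * (y / d) ^+ 2 + c1); last by field.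
have -> : (x, y) != (0, 0) = ((x, y / d) != (0, 0)).
  by rewrite !xpair_eqE mulf_eq0 invr_eq0 (negPf d0) orbF.
exact: rep_cons.
Qed.

Lemma rep_qf s x : rep s (x != 0) (qf s x).
Proof.
elim: s x => [|[a b] s IHs] x.
  rewrite [x]thinmx0 eqxx /qeval mul0mx mul0mx mxE; exact: rep_nil.
rewrite -[x]hsubmxK; set x1 := lsubmx x; set x2 := rsubmx x.
have [u [v x1E]] := rowP2 x1; rewrite [qf _ _]qeval_orth x1E qeval_binary.
have -> : (row_mx (row_mx u%:M v%:M) x2 != 0) = ((u, v) != (0, 0)) || (x2 != 0).
  apply/idP/idP; apply: contraTT; rewrite negb_or !negbK.
    by case/andP => /eqP[-> ->] /eqP->; rewrite !raddf0 !row_mx0.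
  rewrite -row_mx0 => /eqP/eq_row_mx[]; rewrite -row_mx0 => /eq_row_mx[].
  move=> /matrixP/(_ 0 0); rewrite !mxE eqxx mulr1n => ->.
  by move=> /matrixP/(_ 0 0); rewrite !mxE eqxx mulr1n => -> ->; rewrite !eqxx.
exact: rep_cons (IHs x2).
Qed.

Lemma anisotropic_qf s : ~ isotropic s -> anisotropic (qf s).
Proof.
move=> s_an x x0; apply/eqP => sx0; apply: s_an.
by rewrite /isotropic -sx0 -x0; apply: rep_qf.
Qed.

(** The source of all isotropy below: a form that is Witt equivalent to a
    shorter one. *)
Lemma weq_isotropic_size s t : s ~ t -> (size t < size s)%N -> isotropic s.
Proof.
move=> st lt_ts; apply: NNPP => /anisotropic_qf s_an.
have := anisotropic_witt_dim s_an st.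
by rewrite !qdim_qf leq_double leqNgt lt_ts.
Qed.

Lemma isotropic_catl s t : isotropic s -> isotropic (s ++ t).
Proof. by move=> H; have := rep_cat H (rep_zero t); rewrite addr0. Qed.

Lemma isotropic_catr s t : isotropic t -> isotropic (s ++ t).
Proof. by move=> H; have := rep_cat (rep_zero s) H; rewrite addr0. Qed.

(** * Pfister forms *)

(** The tensor product of <<b>> with s. *)
Definition pmul b s : form := s ++ scale b s.
Definition pmuls := foldr pmul.
Definition pf (bs : seq F) a : form := pmuls [:: (1, a)] bs.

Lemma size_pmuls s bs : size (pmuls s bs) = (2 ^ size bs * size s)%N.
Proof.
elim: bs => [|b bs IH] /=; first by rewrite mul1n.
by rewrite size_cat size_scale IH expnS; lia.
Qed.

Lemma weq_pmul b s t : b != 0 -> s ~ t -> pmul b s ~ pmul b t.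
Proof. by move=> b0 st; apply: weq_cat => //; apply: weq_scale. Qed.

Lemma pmul_cat b s t : pmul b (s ++ t) ~ pmul b s ++ pmul b t.
Proof. by rewrite /pmul scale_cat; same_entries. Qed.

Lemma pmul_scale b c s : pmul b (scale c s) = scale c (pmul b s).
Proof. by rewrite /pmul scale_cat scaleC. Qed.

Lemma pmulC b c s : pmul b (pmul c s) ~ pmul c (pmul b s).
Proof. by rewrite /pmul !scale_cat (scaleC b c); same_entries. Qed.

Definition all_unit (bs : seq F) := all (fun b => b != 0) bs.

Lemma weq_pmuls bs s t : all_unit bs -> s ~ t -> pmuls s bs ~ pmuls t bs.
Proof. by move=> + st; elim: bs => //= b bs IH /andP[b0 /IH];
  apply: weq_pmul. Qed.

Lemma pmuls_cat bs s t : all_unit bs ->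
  pmuls (s ++ t) bs ~ pmuls s bs ++ pmuls t bs.
Proof.
elim: bs => //= b bs IH /andP[b0 /IH E]; rewrite -pmul_cat; exact: weq_pmul.
Qed.

Lemma pmuls_scale bs c s : pmuls (scale c s) bs = scale c (pmuls s bs).
Proof. by elim: bs => //= b bs ->; rewrite pmul_scale. Qed.

Lemma pmuls_pmul bs b s : all_unit bs ->
  pmuls (pmul b s) bs ~ pmul b (pmuls s bs).
Proof. by move=> bs0; rewrite pmuls_cat // pmuls_scale. Qed.

(** A form is round when it is multiplied into its own Witt class by each of
    its nonzero values. *)
Definition round s := forall z c, c != 0 -> rep s z c -> scale c s ~ s.

Definition pfister_like s := round s /\ (isotropic s -> s ~ [::]).

(** [1,a] is the norm form of F[w], w^2 = w + a.  For a value c = N(z) the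
    basis (z, wz/c) has determinant 1 and exhibits c [1,a]. *)
Lemma pfister_like_norm a : pfister_like [:: (1, a)].
Proof.
split=> [z c c0 | ].
  case/rep_consE => x [y [z' [c' [/rep_nilE[_ ->] _ /=]]]].
  rewrite mul1r addr0 => cE.
  have det1 : x * ((x + y) / c) + y * (a * y / c) = 1.
    apply: (mulIf c0); rewrite mul1r [in RHS]cE.
    by rewrite -[RHS]addr0 mulrDl !mulrA !divfK //; ring.
  have := weq_binary 1 a det1.
  rewrite mul1r -cE (_ : 1 * _ + _ + _ = a / c); first by rewrite mulr1.
  have -> : 1 * (a * y / c) ^+ 2 + a * y / c * ((x + y) / c) +
            a * ((x + y) / c) ^+ 2 =
    a * (x ^+ 2 + x * y + a * y ^+ 2 + ((x * y + y ^+ 2) + (x * y + y ^+ 2)))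
      / (c ^+ 2) by field.
  by rewrite -cE addrr2 addr0; field.
case/rep_consE => x [y [z' [c' [/rep_nilE[-> ->] /=]]]].
rewrite orbF mul1r addr0 => xy0 /esym N0.
have [y0|y0] := eqVneq y 0.
  move: N0 xy0; rewrite y0 !expr0n !mulr0 !addr0 => /eqP.
  by rewrite expf_eq0 /= => /eqP ->; rewrite eqxx.
have det1 : x * 0 + y * y^-1 = 1 by rewrite mulr0 add0r divff.
by have := weq_binary 1 a det1; rewrite mul1r N0 => <-; apply: weq_isotropic.
Qed.

(** A value of <<b>> s is c = u + b v with u, v values of s or zero.  If both
    are nonzero, s + b s = u s + b v s = c (s + u b v s) = c (s + b s).  If
    c = 0 then b s = u v s = s, so s + b s vanishes. *)
Lemma pfister_like_pmul b s : b != 0 -> pfister_like s ->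
  pfister_like (pmul b s).
Proof.
move=> b0 [s_round s_hyp].
have unit_rep z c : ~ isotropic s -> rep s z c -> c = 0 -> z = false.
  by move=> s_an H c0; case: z H => // H; case: s_an; rewrite /isotropic -c0.
have hyp0 : isotropic s -> pmul b s ~ [::].
  by move/s_hyp => s0; rewrite (weq_pmul b0 s0).
have bK c : c != 0 -> b * c != 0 by move=> ?; apply: mulf_neq0.
split=> [z c c0 | ].
  case/rep_catE => z1 [z2 [u [c2 [H1 /(rep_scaleE b0)[v H2 ->] _ cE]]]].
  have [v0|v0] := eqVneq v 0.
    rewrite v0 mulr0 addr0 in cE; rewrite -cE in H1.
    by rewrite -pmul_scale; apply: weq_pmul => //; apply: s_round H1.
  have vs := s_round _ _ v0 H2.
  have [u0|u0] := eqVneq u 0.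
    rewrite u0 add0r in cE; rewrite cE /pmul scale_cat.
    rewrite -scaleA (weq_scale b0 vs) -scaleA [scale v _]scaleC.
    rewrite (weq_scale b0 (weq_scale b0 vs)) scaleA weq_scale_square //.
    by same_entries.
  have us := s_round _ _ u0 H1.
  have E : pmul b s ~ scale u s ++ scale (b * v) s.
    by rewrite us -scaleA (weq_scale b0 vs).
  rewrite {2}E cE weq_add_scale -?cE ?bK //; apply: weq_scale => //.
  apply: weq_cat => //; rewrite mulrCA -scaleA; apply: weq_scale => //.
  by rewrite -scaleA; symmetry; rewrite (weq_scale u0 vs).
case/rep_catE => z1 [z2 [u [c2 [H1 /(rep_scaleE b0)[v H2 ->] zE /esym cE]]]].
have [s_iso|s_an] := classic (isotropic s); first exact: hyp0.
have [v0|v0] := eqVneq v 0.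
  rewrite v0 mulr0 addr0 in cE.
  by rewrite (unit_rep _ _ s_an H1 cE) (unit_rep _ _ s_an H2 v0) in zE.
have ub : u = b * v by rewrite -[u]addr0 -(addrr2 (b * v)) addrA cE add0r.
have u0 : u != 0 by rewrite ub bK.
rewrite /pmul -{1}(s_round _ _ u0 H1) ub -scaleA (weq_scale b0 (s_round _ _ v0
  H2)).
exact: weq_double.
Qed.

(** * Pfister forms under linkage *)

Definition pfister_list k s :=
  exists bs a, [/\ (size bs).+1 = k, all_unit bs & s = pf bs a].

Lemma pfister_list_pmul k b s :
  b != 0 -> pfister_list k s -> pfister_list k.+1 (pmul b s).
Proof.
move=> b0 [bs [a [sz bs0 ->]]]; exists (b :: bs), a.
by rewrite /= sz b0.
Qed.

Lemma pfister_listS k s : pfister_list k.+2 s ->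
  exists b t, [/\ b != 0, pfister_list k.+1 t & s = pmul b t].
Proof.
move=> [[|b bs] [a [//= [sz] /andP[b0 bs0] ->]]].
by exists b, (pf bs a); split=> //; exists bs, a; rewrite sz.
Qed.

Lemma pfister_list_like k s : pfister_list k s -> pfister_like s.
Proof.
move=> [bs [a [_ + ->]]]; elim: bs => [|b bs IH] /=.
  by move=> _; apply: pfister_like_norm.
by case/andP => b0 /IH; apply: pfister_like_pmul.
Qed.

Lemma size_pf bs a : size (pf bs a) = (2 ^ size bs)%N.
Proof. by rewrite size_pmuls muln1. Qed.

Lemma size_pfister_list k s : pfister_list k.+1 s -> size s = (2 ^ k)%N.
Proof. by move=> [bs [a [[sz] _ ->]]]; rewrite size_pf sz. Qed.

(** The unscaled copies of s cancel; this is why two linked Pfister forms add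
    up to a form of half the expected size. *)
Lemma pmul_sum b c s : pmul b s ++ pmul c s ~ scale b s ++ scale c s.
Proof. by rewrite -[X in _ ~ X](weq_cancel _ s); same_entries. Qed.

Lemma scale_sum b c s : b != 0 ->
  scale b s ++ scale c s ~ scale b (pmul (b * c) s).
Proof.
move=> b0; rewrite /pmul scale_cat scaleA mulrA -scaleA.
by rewrite (weq_scale_square _ b0).
Qed.

Lemma weq_shift a c d e :
  [:: (1, a); (c, d)] ~ [:: (1, a + c * e ^+ 2); (c, d + e ^+ 2)].
Proof.
have swap1 x y p : [:: (x, y); p] ~ [:: (y, x); p].
  by rewrite -cat1s weq_swap.
by rewrite swap1 (swap1 1 (a + _)); have := weq_binary2 a 1 c d e;
  rewrite mul1r => ->.
Qed.

Section Linked.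
(* Here m + 2 is the fold n, so that the common factors u have size 2^m. *)
Variable m : nat.
Hypothesis linked : forall s t, pfister_list m.+2 s -> pfister_list m.+2 t ->
  exists u b c,
    [/\ pfister_list m.+1 u, b != 0, c != 0, s ~ pmul b u & t ~ pmul c u].

Lemma linked_sum s t : pfister_list m.+2 s -> pfister_list m.+2 t ->
  exists2 u, s ++ t ~ u & size u = (2 * 2 ^ m)%N.
Proof.
move=> Ps Pt; have [u [b [c [Pu b0 c0 su tu]]]] := linked Ps Pt.
exists (scale b u ++ scale c u); first by rewrite su tu pmul_sum.
by rewrite size_cat !size_scale (size_pfister_list Pu); lia.
Qed.

Lemma pf_arf bs a b : all_unit bs -> pf bs (a + b) ~ pf bs a ++ pf bs b.
Proof.
by move=> bs0; rewrite -pmuls_cat //; apply: weq_pmuls; rewrite //= weq_arf.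
Qed.

(** Pfister forms of fold n + 2 vanish.  Write s = B <<d,b,c,f]] with B of fold
    n - 2.  Adding vectors of c[1,f] to a basis vector of [1,f] shows that
    <<c,f]] also contains [1,a1] and [1,a2], and r below is chosen to achieve
    f = a1 + a2.  Thus s contains B tensored with the Albert form
    [1,a1+a2] + b[1,a2] + d[1,a1], which is Witt equivalent to the sum of
    B <<b,a2]] and B <<d,a1]].  These are linked, so that their sum has
    two thirds of the dimension of the subform: s is isotropic, hence
    hyperbolic. *)
Lemma pfister_hyperbolic s : pfister_list m.+4 s -> s ~ [::].
Proof.
move=> Ps; apply: (proj2 (pfister_list_like Ps)).
case: Ps => [[|d [|b bs]] [f [//= [sz]]]].
case/lastP: bs sz => // bs c; rewrite size_rcons => -[sz].
rewrite /all_unit /= all_rcons => /and4P[d0 b0 c0 bs0] sE.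
(* With N the norm form [1,f], a1 + a2 = c (N(r,1) + N(r,0)) = c (r + f). *)
pose r := f + f / c; pose a2 := f + c * r ^+ 2.
pose n1 := c * (r ^+ 2 + r + f); pose a1 := f + n1.
have fE : f = a1 + a2.
  have -> : a1 + a2 = c * (f / c) + ((f + c * r ^+ 2 + c * f) +
                                     (f + c * r ^+ 2 + c * f)).
    by rewrite /a1 /a2 /n1 {2}/r; ring.
  by rewrite addrr2 addr0; field.
pose P := [:: (1, f); (c, f / c)]; pose Q := pmuls P bs.
have Q0 : Q ~ pf bs f ++ pmuls [:: (c, f / c)] bs by rewrite -pmuls_cat.
have Q2 : Q ~ pf bs a2 ++ pmuls [:: (c, f / c + r ^+ 2)] bs.
  by rewrite -pmuls_cat //; apply: weq_pmuls => //; apply: weq_shift.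
have Q1 : Q ~ pf bs a1 ++ pmuls [:: (n1, c^-1 + 1)] bs.
  rewrite -pmuls_cat //; apply: weq_pmuls => //; rewrite /P.
  rewrite -[X in X ~ _]cat1s -[X in _ ++ X](_ : [:: (n1, c^-1)] ~ _).
    by have := weq_shift f n1 c^-1 1; rewrite expr1n mulr1.
  have det1 : r * 0 + c * c^-1 = 1 by rewrite mulr0 add0r divff.
  have := weq_binary c (f / c) det1.
  rewrite !expr0n !mulr0 !addr0 (_ : c * c^-1 ^+ 2 = c^-1); last by field.
  by rewrite (_ : _ + _ + _ = n1) //; rewrite /n1; field.
have [u uE szu] : exists2 u, pmul b (pf bs a2) ++ pmul d (pf bs a1) ~ u &
    size u = (2 * 2 ^ m)%N.
  apply: linked_sum.
    by exists (b :: bs), a2; rewrite /= sz b0.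
  by exists (d :: bs), a1; rewrite /= sz d0.
pose C0 := pmuls [:: (c, f / c)] bs.
pose C1 := pmuls [:: (n1, c^-1 + 1)] bs.
pose C2 := pmuls [:: (c, f / c + r ^+ 2)] bs.
have sQ : s = pmul d (pmul b Q).
  by rewrite sE /pf /pmuls /= foldr_rcons /= /pmul /= mulr1.
(* The three shapes of Q each supply one plane of the Albert form; v consists
   of u and of all the complements, 7 * 2 ^ m entries against 8 * 2 ^ m. *)
pose v := u ++ C0 ++ scale b C2 ++ scale d C1 ++ scale d (scale b Q).
apply: (@weq_isotropic_size _ v).
  have pfE : pf bs f ~ pf bs a1 ++ pf bs a2 by rewrite {1}fE; apply: pf_arf.
  rewrite sQ /pmul scale_cat.
  transitivity (((pf bs f ++ C0) ++ scale b (pf bs a2 ++ C2)) ++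
      scale d (pf bs a1 ++ C1) ++ scale d (scale b Q)).
    by apply: weq_cat; apply: weq_cat => //; apply: weq_scale.
  by rewrite pfE /v -uE /pmul !scale_cat; same_entries.
rewrite /v sQ /Q /P; rewrite !(size_cat, size_scale, size_pmuls) szu sz /=.
by have := expn_gt0 2 m; lia.
Qed.

(** Folds n + 1 ignore scalars, as <<c>> s has fold n + 2. *)
Lemma pfister_universal s c : pfister_list m.+3 s -> c != 0 -> scale c s ~ s.
Proof.
move=> Ps c0; symmetry; apply: weq_add0.
exact/pfister_hyperbolic/pfister_list_pmul.
Qed.

Lemma round_slot b z c s : b != 0 -> c != 0 -> round s -> rep s z c ->
  pmul (b * c) s ~ pmul b s.
Proof.
move=> b0 c0 s_round /s_round sc; apply: weq_cat => //.
by rewrite -scaleA; apply: weq_scale => //; apply: sc.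
Qed.

(** The bilinear identity <<x,y>> = <<x+y,xy>>, acting on s. *)
Lemma pmul_add x y s : x != 0 -> y != 0 -> x + y != 0 ->
  pmul x (pmul y s) ~ pmul (x + y) (pmul (x * y) s).
Proof.
move=> x0 y0 xy0.
rewrite -[pmul (x + y) _]/(pmul (x * y) s ++
                           scale (x + y) (s ++ scale (x * y) s)).
rewrite -weq_add_scale // /pmul scale_cat scaleA.
by same_entries.
Qed.

(** The complement of s in <<c,b>> s, known as its pure part relative to s. *)
Definition pure b c s : form := scale b s ++ scale c (pmul b s).

Lemma pmul_pure b c s : pmul c (pmul b s) = s ++ pure b c s.
Proof. by rewrite /pure catA. Qed.

(** Write p = b u + c v with u a value of s and v one of <<b>> s.  Roundness
    allows replacing b by b u and c by c v, and then b + c becomes a slot. *)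
Lemma pure_slot b c s z p : b != 0 -> c != 0 -> pfister_like s -> p != 0 ->
  rep (pure b c s) z p ->
  exists2 c', c' != 0 & pmul c (pmul b s) ~ pmul c' (pmul p s).
Proof.
move=> b0 c0 s_pf p0; have [s_round _] := s_pf.
have [bs_round _] := pfister_like_pmul b0 s_pf.
case/rep_catE => z1 [z2 [? [? [/(rep_scaleE b0)[u Hu ->]]]]].
move=> /(rep_scaleE c0)[v Hv ->] _ pE.
have [u0|u0] := eqVneq u 0.
  rewrite u0 mulr0 add0r in pE.
  have v0 : v != 0 by apply: contraNneq p0 => v0; rewrite pE v0 mulr0.
  exists b => //; rewrite -(round_slot c0 v0 bs_round Hv) -pE.
  exact: pmulC.
have bE := round_slot b0 u0 s_round Hu.
have [v0|v0] := eqVneq v 0.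
  rewrite v0 mulr0 addr0 in pE; exists c => //.
  by apply: weq_pmul => //; rewrite pE bE.
have cv0 : c * v != 0 by rewrite mulf_neq0.
have bu0 : b * u != 0 by rewrite mulf_neq0.
exists (b * u * (c * v)); first by rewrite mulf_neq0.
rewrite -(round_slot c0 v0 bs_round Hv) -(weq_pmul cv0 bE) (pmulC (c * v)).
by rewrite pmul_add -?pE //; apply: pmulC.
Qed.

Lemma common_value s t : isotropic (s ++ t) -> ~ isotropic s -> ~ isotropic t ->
  exists p : F, [/\ p != 0, rep s true p & rep t true p].
Proof.
have nz u z c : ~ isotropic u -> rep u z c -> z = (c != 0).
  move=> u_an; case: z => H; last by rewrite (rep_false H) eqxx.
  by apply/esym/negP => /eqP c0; apply: u_an; rewrite /isotropic -c0.
move=> /rep_catE[z1 [z2 [c1 [c2 [H1 H2 zE cE]]]]] s_an t_an.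
have c12 : c1 = c2 by rewrite -[c1]addr0 -(addrr2 c2) addrA -cE add0r.
have z1E := nz _ _ _ s_an H1; have z2E := nz _ _ _ t_an H2.
move: zE H1 H2; rewrite z1E z2E c12 orbb => c0; rewrite -c0 => H1 H2.
by exists c2.
Qed.

Lemma rep_pmuls s bs z c : rep s z c -> rep (pmuls s bs) z c.
Proof.
move=> H; elim: bs => //= b bs IH.
by have := rep_cat IH (rep_zero (scale b (pmuls s bs))); rewrite orbF addr0.
Qed.

Lemma rep_pf_slot bs a : rep (pf bs a) true a.
Proof.
apply: rep_pmuls; have := rep_cons 1 a 0 1 rep_nil.
by rewrite expr0n expr1n !mulr0 mul0r mulr1 !addr0 !add0r xpair_eqE oner_eq0
  andbF.
Qed.

Definition share s t := exists u (x y : F),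
  [/\ pfister_list m.+2 u, x != 0, y != 0, s ~ pmul x u & t ~ pmul y u].

Lemma common_value_share u b c d e : pfister_list m.+1 u ->
  b != 0 -> c != 0 -> d != 0 -> e != 0 ->
  (exists p : F,
    [/\ p != 0, rep (pure b c u) true p & rep (pure d e u) true p]) ->
  share (pmul c (pmul b u)) (pmul e (pmul d u)).
Proof.
move=> Pu b0 c0 d0 e0 [p [p0 H1 H2]].
have u_pf := pfister_list_like Pu.
have [c' c'0 E1] := pure_slot b0 c0 u_pf p0 H1.
have [e' e'0 E2] := pure_slot d0 e0 u_pf p0 H2.
by exists (pmul p u), c', e'; split=> //; apply: pfister_list_pmul.
Qed.

Lemma share_weq s s' t t' : s ~ s' -> t ~ t' ->
  (~ (s' ~ [::]) -> ~ (t' ~ [::]) -> share s' t') ->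
  ~ (s ~ [::]) -> ~ (t ~ [::]) -> share s t.
Proof.
move=> ss' tt' sh s0 t0.
have [||u [x [y [Pu x0 y0 sE tE]]]] := sh; rewrite -?ss' -?tt' //.
by exists u, x, y; split=> //; [rewrite ss' | rewrite tt'].
Qed.

Lemma pure_anisotropic b c u : pfister_list m.+1 u -> b != 0 -> c != 0 ->
  ~ (pmul c (pmul b u) ~ [::]) ->
  ~ isotropic (pmul c (pmul b u)) /\ ~ isotropic (pure b c u).
Proof.
move=> Pu b0 c0 nhyp.
have T_an : ~ isotropic (pmul c (pmul b u)).
  have Ps : pfister_list m.+3 (pmul c (pmul b u)).
    by do 2!apply: pfister_list_pmul => //.
  by move/(proj2 (pfister_list_like Ps)).
by split=> //; rewrite pmul_pure in T_an => /(isotropic_catr u).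
Qed.

(** The case in which the slots b and d add up to the last slot of u, so that
    [1,b+d] + [1,d] + [1,b] = 0.  Let B be the bilinear form with slots bs.
    The two pure parts together contain B times the Albert form
    b[1,b+d] + c[1,d] + e[1,b], since <<b,b+d]] contains [1,d] and <<d,b+d]]
    contains [1,b].  It is Witt equivalent to b (<<bc,d]] + <<be,b]]), which
    linkage shortens.  So the sum of the pure parts is isotropic, and an
    isotropic vector is a common value of the two. *)
Lemma share_arf bs b c d e : size bs = m -> all_unit bs ->
  b != 0 -> c != 0 -> d != 0 -> e != 0 ->
  let u := pf bs (b + d) in
  ~ (pmul c (pmul b u) ~ [::]) -> ~ (pmul e (pmul d u) ~ [::]) ->
  share (pmul c (pmul b u)) (pmul e (pmul d u)).
Proof.
move=> szb bs0 b0 c0 d0 e0 u nhyp1 nhyp2.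
have Pu : pfister_list m.+1 u by exists bs, (b + d); rewrite szb.
have [_ an1] := pure_anisotropic Pu b0 c0 nhyp1.
have [_ an2] := pure_anisotropic Pu d0 e0 nhyp2.
apply: common_value_share => //; apply: common_value => //.
have slotE x y : x != 0 -> pmul x (pf bs (x + y)) ~
    pf bs y ++ pmuls [:: (x, (x + y) / x + 1)] bs.
  move=> x0; rewrite -pmuls_pmul // -pmuls_cat //; apply: weq_pmuls => //.
  have := weq_shift (x + y) x ((x + y) / x) 1.
  rewrite /pmul /= !expr1n !mulr1 => ->.
  by rewrite addrAC addrr2 add0r.
pose R1 := pmuls [:: (b, (b + d) / b + 1)] bs.
pose R2 := pmuls [:: (d, (d + b) / d + 1)] bs.
have E1 : pmul b u ~ pf bs d ++ R1 by apply: slotE.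
have E2 : pmul d u ~ pf bs b ++ R2 by rewrite /u addrC; apply: slotE.
have [v vE szv] : exists2 v,
    pmul (b * c) (pf bs d) ++ pmul (b * e) (pf bs b) ~ v &
    size v = (2 * 2 ^ m)%N.
  apply: linked_sum; [exists (b * c :: bs), d | exists (b * e :: bs), b];
    by rewrite /= szb mulf_neq0.
apply: (@weq_isotropic_size _
  (scale b v ++ scale c R1 ++ scale d u ++ scale e R2)).
  rewrite /pure (weq_scale c0 E1)
    (weq_scale e0 E2) {1}/u (weq_scale b0 (pf_arf _ _ bs0)).
  rewrite -(weq_scale b0 vE) (scale_cat b (pmul _ _)) -!scale_sum // !scale_cat.
  by same_entries.
rewrite /pure /R1 /R2 /u !(size_cat, size_scale, size_pmuls) szv szb /=.
by have := expn_gt0 2 m; lia.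
Qed.

(** Linkage of fold n passes to fold n + 1.  Over a common u, the forms are
    <<c,b>> u and <<e,d>> u.  As the first is insensitive to scaling by d, its
    sum with the pure part of the second loses two copies of d u and is
    isotropic: n + p = q with n, p, q values of u and of the two pure parts.
    If n = 0 there is a common slot.  Otherwise n is moved to the last slot a
    of u and the slots p a/n, q a/n add up to a. *)
Lemma pfister_share s t : pfister_list m.+3 s -> pfister_list m.+3 t ->
  ~ (s ~ [::]) -> ~ (t ~ [::]) -> share s t.
Proof.
move=> /pfister_listS[c [s' [c0 Ps' ->]]] /pfister_listS[e [t' [e0 Pt' ->]]].
have [u [b [d [Pu b0 d0 sE tE]]]] := linked Ps' Pt'.
apply: share_weq (weq_pmul c0 sE) (weq_pmul e0 tE) _.
move=> {s' t' Ps' Pt' sE tE} nhyp1 nhyp2.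
have [an1 anp1] := pure_anisotropic Pu b0 c0 nhyp1.
have [an2 anp2] := pure_anisotropic Pu d0 e0 nhyp2.
have u_pf := pfister_list_like Pu; have [u_round _] := u_pf.
have [q [q0 H1 H2]] : exists q : F, [/\ q != 0, rep (pmul c (pmul b u)) true q &
    rep (pure d e u) true q].
  apply: common_value => //.
  pose v := scale d (pure b c u) ++ scale e (pmul d u).
  apply: (@weq_isotropic_size _ v).
    have Ps : pfister_list m.+3 (pmul c (pmul b u)).
      by do 2!apply: pfister_list_pmul => //.
    rewrite -{1}(pfister_universal Ps d0) pmul_pure /v scale_cat {2}/pure.
    rewrite -[X in _ ~ X](weq_cancel _ (scale d u)).
    by same_entries.
  rewrite /v /pure !(size_cat, size_scale) (size_pfister_list Pu).
  by have := expn_gt0 2 m; lia.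
rewrite pmul_pure in H1.
have [z1 [z2 [n [p [Hn Hp _ qE]]]]] := rep_catE H1.
have [n0|n0] := eqVneq n 0.
  rewrite n0 add0r in qE; apply: common_value_share => //; exists q; split=> //.
  rewrite qE in q0 *; case: z2 Hp => // /rep_false p0.
  by rewrite p0 eqxx in q0.
have [p0|p0] := eqVneq p 0.
  case: an2; rewrite /isotropic pmul_pure -[0](addrr2 q).
  by rewrite {1}qE p0 addr0 -(orbT z1); apply: rep_cat.
have [c1 c10 E1] := pure_slot b0 c0 u_pf p0 Hp.
have [e1 e10 E2] := pure_slot d0 e0 u_pf q0 H2.
have [bs [a [[szb] bs0 uE]]] := Pu.
have Ha : rep u true a by rewrite uE; apply: rep_pf_slot.
have a0 : a != 0.
  apply/eqP => a0; case: an1; rewrite pmul_pure; apply: isotropic_catl.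
  by rewrite /isotropic -a0.
have an0 : a / n != 0 by rewrite mulf_neq0 ?invr_eq0.
have anu : scale (a / n) u ~ u.
  rewrite -(weq_scale an0 (u_round _ _ n0 Hn)) scaleA divfK //.
  exact: u_round Ha.
have slot x : x != 0 -> pmul x u ~ pmul (x * (a / n)) u.
  by move=> x0; apply: weq_cat => //; rewrite -scaleA; apply: weq_scale => //;
    rewrite anu.
have pqn : p + q = n by rewrite qE addrCA addrr2 addr0.
have aE : a = p * (a / n) + q * (a / n).
  by rewrite -mulrDl pqn mulrCA divff ?mulr1.
have F1 : pmul c (pmul b u) ~ pmul c1 (pmul (p * (a / n)) u).
  by rewrite E1; apply: weq_pmul => //; apply: slot.
have F2 : pmul e (pmul d u) ~ pmul e1 (pmul (q * (a / n)) u).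
  by rewrite E2; apply: weq_pmul => //; apply: slot.
have pa0 := mulf_neq0 p0 an0; have qa0 := mulf_neq0 q0 an0.
apply: share_weq F1 F2 _ nhyp1 nhyp2.
move: (p * (a / n)) (q * (a / n)) pa0 qa0 aE => b1 d1 b10 d10 aE.
by rewrite uE aE; apply: share_arf.
Qed.

Lemma pfister_sum s t : pfister_list m.+3 s -> pfister_list m.+3 t ->
  exists2 u, pfister_list m.+3 u & s ++ t ~ u.
Proof.
move=> Ps Pt; have [s0|s_n0] := classic (s ~ [::]).
  by exists t; rewrite // s0.
have [t0|t_n0] := classic (t ~ [::]).
  by exists s; rewrite // t0 cats0.
have [u [x [y [Pu x0 y0 sE tE]]]] := pfister_share Ps Pt s_n0 t_n0.
have Pv : pfister_list m.+3 (pmul (x * y) u).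
  by apply: pfister_list_pmul; rewrite ?mulf_neq0.
exists (pmul (x * y) u) => //.
by rewrite sE tE pmul_sum scale_sum // (pfister_universal Pv).
Qed.

(** The first form and a factor of fold n of the second are linked through some
    u of fold n - 1, and b u + d u + c <<d>> u is what remains of their sum. *)
Lemma pfister_mixed_sum s t : pfister_list m.+2 s -> pfister_list m.+3 t ->
  exists2 u, s ++ t ~ u & size u = (2 ^ m.+2)%N.
Proof.
move=> Ps /pfister_listS[c [t' [c0 Pt' ->]]].
have [u [b [d [Pu b0 d0 sE tE]]]] := linked Ps Pt'.
exists ((scale b u ++ scale d u) ++ scale c (pmul d u)).
  by rewrite sE (weq_pmul c0 tE) -pmul_sum -catA.
by rewrite !(size_cat, size_scale) (size_pfister_list Pu) !expnS; lia.
Qed.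

Lemma scale_pfister c s : scale c s ~ s ++ pmul c s.
Proof. by rewrite -(weq_cancel (scale c s) s); same_entries. Qed.

Lemma hyperbolic_pfister k : exists2 s, pfister_list k.+1 s & s ~ [::].
Proof.
have P0 : pfister_list k.+1 (pf (nseq k 1) 0).
  by exists (nseq k 1), 0; rewrite size_nseq /all_unit all_nseq oner_eq0 orbT.
exists (pf (nseq k 1) 0) => //.
exact/(proj2 (pfister_list_like P0))/rep_pf_slot.
Qed.

End Linked.

(** * Transfer to quadratic forms *)

Lemma anisotropic_isometric (q1 q2 : qform F) :
  isometric q1 q2 -> anisotropic q2 -> anisotropic q1.
Proof.
move=> /isometricP[M [N [MN NM Mq]]] q2_an x x0; rewrite -Mq; apply: q2_an.
by apply: contraNneq x0 => xM0; rewrite -[x]mulmx1 -MN mulmxA xM0 mul0mx.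
Qed.

Lemma qpfister_qf bs a : all_unit bs ->
  isometric (qpfister bs a) (qf (pf bs a)).
Proof.
elim: bs => [|b bs IH] /=.
  by move=> _; apply: isometric_sym; apply: isometric_orth0.
case/andP => b0 /IH bsE; apply: isometric_trans (isometric_sym (qf_cat _ _)).
apply: isometric_orth => //.
apply: isometric_trans (isometric_sym (qf_scale _ b0)).
exact: isometric_scale.
Qed.

Lemma is_qpfisterP k q : is_qpfister k q ->
  exists2 s, pfister_list k s & isometric q (qf s).
Proof.
move=> [bs [a [sz bs0 qE]]]; exists (pf bs a); first by exists bs, a.
exact: isometric_trans qE (qpfister_qf _ bs0).
Qed.

Lemma pfister_list_qf k s : pfister_list k s -> is_qpfister k (qf s).
Proof.
move=> [bs [a [sz bs0 ->]]]; exists bs, a; split=> //.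
exact/isometric_sym/qpfister_qf.
Qed.

Lemma bqtensor_bbinary b (q : qform F) :
  isometric (bqtensor (bpfister [:: b]) q) (qorth q (qscale b q)).
Proof.
have dimE : ((1 + 1) * 1 * qdim q = qdim q + qdim q)%N by lia.
apply: (@isometric_reindex _ (bqtensor (bpfister [:: b]) q)
  (qorth q (qscale b q))
  (cast_ord dimE) (cast_ord (esym dimE))) => [||i j].
- exact: cast_ordK.
- exact: cast_ordKV.
have castE (k : 'I_2) (l : 'I_(qdim q)) : cast_ord dimE
    (mxtens_index (mxtens_index (k, 0), l)) =
    if k == 0 then lshift _ l else rshift _ l.
  by apply: val_inj; case: k => [[|[|]]] //= ?; lia.
case: (mxtens_indexP i) => i1 i2; case: (mxtens_indexP j) => j1 j2.
case: (mxtens_indexP i1) => i0 z; rewrite [z]ord1 {z}.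
case: (mxtens_indexP j1) => j0 z; rewrite [z]ord1 {z}.
rewrite !castE /= !tensmxE [1%:M 0 0]mxE mulr1.
by case: (split_ordP i0) => z ->; case: (split_ordP j0) => z' ->;
  rewrite [z]ord1 [z']ord1 ?(block_mxEul, block_mxEur, block_mxEdl,
    block_mxEdr);
  rewrite !mxE ?mul0r ?mul1r.
Qed.

Lemma bdim_bpfister (bs : seq F) : bdim (bpfister bs) = (2 ^ size bs)%N.
Proof. by elim: bs => //= b bs ->; rewrite expnS. Qed.

Lemma qdim_is_qpfister k (q : qform F) : is_qpfister k q -> qdim q = (2 ^ k)%N.
Proof.
case: k => [[bs [a [//]]]|k] /is_qpfisterP[s Ps /isometric_dim ->].
by rewrite qdim_qf (size_pfister_list Ps) expnS; lia.
Qed.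

(** * The invariant u^n *)

Section Iq.
Variable m : nat.
Hypothesis Iq_linked : Iq_separably_linked F m.+2.

(** Comparing dimensions, the two bilinear factors over the common quadratic
    factor have exactly one slot each. *)
Lemma pfister_list_linked s t : pfister_list m.+2 s -> pfister_list m.+2 t ->
  exists u b c,
    [/\ pfister_list m.+1 u, b != 0, c != 0, s ~ pmul b u & t ~ pmul c u].
Proof.
move=> Ps Pt.
have [phi [bs [cs [Pphi bs0 cs0 sE tE]]]] :=
  Iq_linked (pfister_list_qf Ps) (pfister_list_qf Pt).
have [u Pu phiE] := is_qpfisterP Pphi.
have slot r (ds : seq F) : pfister_list m.+2 r -> all_unit ds ->
    isometric (qf r) (bqtensor (bpfister ds) phi) ->
    exists2 d, d != 0 & r ~ pmul d u.
  move=> Pr + rE; have := isometric_dim rE.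
  rewrite /= bdim_bpfister (qdim_is_qpfister Pphi).
  rewrite (qdim_is_qpfister (pfister_list_qf Pr)) -expnD.
  move/eqP; rewrite eqn_exp2l // => /eqP sizeE.
  have {sizeE} ds1 : size ds = 1%N by lia.
  case: ds ds1 rE => [|d [|//]] //= _ rE /andP[d0 _]; exists d => //.
  apply: isometric_witt; apply: isometric_trans rE _.
  apply: isometric_trans (bqtensor_bbinary _ _) _.
  apply: isometric_trans (isometric_sym (qf_cat _ _)).
  apply: isometric_orth => //.
  apply: isometric_trans (isometric_sym (qf_scale _ d0)).
  exact: isometric_scale.
have [b b0 sE'] := slot _ _ Ps bs0 sE; have [c c0 tE'] := slot _ _ Pt cs0 tE.
by exists u, b, c.
Qed.

Let linked := pfister_list_linked.

(** Linkage turns the sum of two n-fold forms into a multiple b s of a third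
    one, and b s = s + <<b>> s moves the scalar into fold n + 1, where sums of
    Pfister forms are again Pfister forms. *)
Lemma in_Iq_decomposition q : in_Iq m.+2 q -> exists s t,
  [/\ pfister_list m.+2 s, pfister_list m.+3 t & witt_equiv q (qf (s ++ t))].
Proof.
elim=> {q} [c q c0 /is_qpfisterP[s Ps qE] | | q1 q2 _ [s1 [t1 [Ps1 Pt1 E1]]]
  _ [s2 [t2 [Ps2 Pt2 E2]]] | q _ [s [t [Ps Pt qE]]] |
  q1 q2 _ [s [t [Ps Pt qE]]] _ q12].
- exists s, (pmul c s); split=> //; first exact: pfister_list_pmul.
  apply: witt_trans (scale_pfister c s); apply: isometric_witt.
  apply: isometric_trans (isometric_sym (qf_scale _ c0)).
  exact: isometric_scale.
- have [s Ps s0] := hyperbolic_pfister m.+1.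
  have [t Pt t0] := hyperbolic_pfister m.+2.
  by exists s, t; split=> //; rewrite -/(qf [::]); apply: weq_sym;
    rewrite s0 t0.
- have [u [b [c [Pu b0 c0 s1E s2E]]]] := linked Ps1 Ps2.
  have bc0 : b * c != 0 by rewrite mulf_neq0.
  pose s := pmul (b * c) u.
  have Ps : pfister_list m.+2 s by apply: pfister_list_pmul.
  have [t3 Pt3 t3E] := pfister_sum linked Pt1 Pt2.
  have [t Pt tE] := pfister_sum linked (pfister_list_pmul b0 Ps) Pt3.
  exists s, t; split=> //; apply: witt_trans (witt_orth E1 E2) _.
  apply: witt_trans (isometric_witt (isometric_sym (qf_cat _ _))) _.
  have sE : s1 ++ s2 ~ s ++ pmul b s.
    by rewrite s1E s2E pmul_sum scale_sum // scale_pfister.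
  rewrite -[witt_equiv _ _]/(_ ~ _) -tE -t3E.
  transitivity ((s1 ++ s2) ++ (t1 ++ t2)); first by same_entries.
  by rewrite sE; same_entries.
- exists s, t; split=> //; apply: witt_trans qE.
  rewrite (_ : -1 = 1); last by apply/eqP; rewrite eq_sym -subr_eq0 opprK char2.
  by rewrite qscale1; apply: witt_refl.
- by exists s, t; split=> //; apply: witt_trans (witt_sym q12) qE.
Qed.

Lemma in_Iq_scale_pfister c s : c != 0 -> pfister_list m.+2 s ->
  in_Iq m.+2 (qscale c (qf s)).
Proof. by move=> c0 Ps; apply: in_Iq_gen => //; apply: pfister_list_qf. Qed.

Lemma u_invariant_of_pfisterS t : pfister_list m.+3 t -> ~ (t ~ [::]) ->
  is_u_invariant F m.+2 (2 ^ m.+3).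
Proof.
move=> Pt t_n0; split=> [|q].
  have [b [s [b0 Ps tE]]] := pfister_listS Pt.
  exists (qorth (qscale 1 (qf s)) (qscale b (qf s))); split.
  - by apply: in_Iq_add; apply: in_Iq_scale_pfister; rewrite ?oner_eq0.
  - have : anisotropic (qf t).
      by apply: anisotropic_qf => /(proj2 (pfister_list_like Pt)).
    apply: anisotropic_isometric; rewrite tE.
    apply: isometric_trans (isometric_sym (qf_cat _ _)).
    rewrite qscale1; apply: isometric_orth; first exact: isometric_refl.
    exact/isometric_sym/qf_scale.
  - by rewrite /= qdim_qf (size_pfister_list Ps) !expnS; lia.
move=> /in_Iq_decomposition[s [t' [Ps Pt' qE]]] q_an.
have [u uE szu] := pfister_mixed_sum linked Ps Pt'.
have := anisotropic_witt_dim q_an (witt_trans qE uE).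
by rewrite qdim_qf szu !expnS; lia.
Qed.

Lemma u_invariant_of_hyperbolic :
  (forall t, pfister_list m.+3 t -> t ~ [::]) -> Iq_nonzero F m.+2 ->
  is_u_invariant F m.+2 (2 ^ m.+2).
Proof.
move=> hyp.
have Iq_pfister q : in_Iq m.+2 q ->
    exists2 s, pfister_list m.+2 s & witt_equiv q (qf s).
  move=> /in_Iq_decomposition[s [t [Ps Pt qE]]]; exists s => //.
  by apply: witt_trans qE _; rewrite -[witt_equiv _ _]/(_ ~ _) (hyp _ Pt) cats0.
move=> [q /Iq_pfister[s Ps qE] q_n0];
  split=> [|q' /Iq_pfister[s' Ps' qE'] q_an].
  exists (qscale 1 (qf s)); split.
  - by apply: in_Iq_scale_pfister; rewrite ?oner_eq0.
  - have : anisotropic (qf s).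
      apply: anisotropic_qf => /(proj2 (pfister_list_like Ps)) s0.
      exact: q_n0 (witt_trans qE s0).
    by rewrite qscale1.
  - by rewrite /= qdim_qf (size_pfister_list Ps) !expnS; lia.
have := anisotropic_witt_dim q_an qE'.
by rewrite qdim_qf (size_pfister_list Ps') !expnS; lia.
Qed.

End Iq.

End WittClasses.

Theorem theorem5p1 (F : fieldType) (n : nat) (n_ge2 : (2 <= n)%N)
    (charF2 : 2%N \in [pchar F]%R) (Iq_neq0 : Iq_nonzero F n)
    (Iq_linked : Iq_separably_linked F n) :
  exists u : nat,
    [/\ is_u_invariant F n u,
        u = (2 ^ n)%N \/ u = (2 ^ n.+1)%N
      & forall phi : qform F,
          in_Iq n phi -> anisotropic phi -> qdim phi = u ->
          exists pi psi : qform F,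
            [/\ is_qpfister n pi, is_qpfister n.+1 psi
              & witt_equiv phi (qorth pi psi)]].
Proof.
have char2 := GRing.addrr_pchar2 charF2 (GRing.one F).
case: n n_ge2 Iq_neq0 Iq_linked => [|[|m]] // _ Iq_neq0 Iq_linked.
have dec phi : in_Iq m.+2 phi -> exists pi psi : qform F,
    [/\ is_qpfister m.+2 pi, is_qpfister m.+3 psi & witt_equiv phi (qorth pi psi)].
  move=> /(in_Iq_decomposition char2 Iq_linked)[s [t [Ps Pt phiE]]].
  exists (qf s), (qf t); split; do ?exact: pfister_list_qf.
  exact: witt_trans phiE (isometric_witt (qf_cat _ _)).
have [[t [Pt t_n0]]|hyp] :=
  classic (exists t, pfister_list (F := F) m.+3 t /\ ~ weq t [::]).
  exists (2 ^ m.+3)%N; split=> [||phi /dec //]; last by right.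
  exact: u_invariant_of_pfisterS Pt t_n0.
exists (2 ^ m.+2)%N; split=> [||phi /dec //]; last by left.
apply: u_invariant_of_hyperbolic => // t Pt.
by apply: NNPP => t_n0; apply: hyp; exists t.
Qed.
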